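(* Let $A$ be an associative or Lie algebra over $K$, let $\lambda:G\to\operatorname{End}_0(A)$ be an ideal partial representation of $G$ on $A$, and let $(\pi,M)$ be a covariant representation of $\lambda$. Then $\Lambda(M)$ is a $\Lambda(A)$-module, with action of $\Lambda(A)$ on $\Lambda(M)$ given by $$\lfloor g,x\rfloor\lfloor h,m\rfloor=\lfloor g,x\,\pi_{g^{-1}h}(m)\rfloor,$$ where $\lfloor g,x\rfloor\in\Lambda(A)$ and $\lfloor h,m\rfloor\in\Lambda(M)$. Moreover, $$\lfloor g,x\rfloor\lfloor h,m\rfloor=\lfloor h,\lambda_{h^{-1}g}(x)\,m\rfloor$$ for all $g,h\in G$, $x\in A$ and $m\in M$.
   Context: $K$ is an associative commutative unital ring, all modules, algebras and tensor products are over $K$, and $G$ is a group. Associative algebras may or may not have a unit. $\operatorname{End}_0(A)$ is the monoid of algebra endomorphisms of $A$ (not required to preserve a unit). A partial representation of $G$ in a monoid $S$ is a map $\pi:G\to S$ with $\pi_1=1_S$, $\pi_{g^{-1}}\pi_g\pi_h=\pi_{g^{-1}}\pi_{gh}$ and $\pi_g\pi_h\pi_{h^{-1}}=\pi_{gh}\pi_{h^{-1}}$ for all $g,h\in G$. An ideal partial representation of $G$ on $A$ is a partial representation $\lambda:G\to\operatorname{End}_0(A)$ such that each $\operatorname{im}\lambda_g$ is a two-sided ideal of $A$. An $A$-module $M$ is a $K$-module with a $K$-bilinear map $A\times M\to M$, $(x,m)\mapsto xm$, such that $(xy)m=x(ym)$ if $A$ is associative (left module), and $(x\cdot y)m=x(ym)-y(xm)$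 if $A$ is a Lie algebra with product $\cdot$. A covariant representation of $\lambda$ is a pair $(\pi,M)$ with $M$ an $A$-module and $\pi:G\to\operatorname{End}_K(M)$ a partial representation such that for all $g\in G$, $x\in A$, $m\in M$: (1) $\pi_g(xm)=\lambda_g(x)\pi_g(m)$; (2) $\varepsilon_g(xm)=e_g(x)m=x\varepsilon_g(m)$, where $\varepsilon_g=\pi_g\pi_{g^{-1}}$ and $e_g=\lambda_g\lambda_{g^{-1}}$. For a $K$-module $N$ with partial representation $\rho:G\to\operatorname{End}_K(N)$, $\Lambda(N)$ is the quotient of $KG\otimes N$ by the submodule generated by all $g\otimes\rho_h(n)-gh\otimes n$ with $g,h\in G$, $n\in\operatorname{im}\rho_{h^{-1}}$, and $\lfloor g,n\rfloor$ is the class of $g\otimes n$. $\Lambda(A)$ is formed with $\lambda$ and $\Lambda(M)$ with $\pi$. $\Lambda(A)$ is an associative (respectively Lie) algebra with the product $\lfloor g,x\rfloor\lfloor h,y\rfloor=\lfloor g,x\cdot\lambda_{g^{-1}h}(y)\rfloor$. *)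

(* Defs.v *)
From HB Require Import structures.
From mathcomp Require Import all_boot all_order all_algebra.
From mathcomp Require Import finmap.
From mathcomp Require Import boolp classical_sets functions cardinality.

Set Implicit Arguments.
Unset Strict Implicit.
Unset Printing Implicit Defensive.

Import GRing.Theory.
Local Open Scope classical_set_scope.
Local Open Scope ring_scope.

Section LinearFacts.
Variables (K : comPzRingType) (V W : lmodType K) (phi : V -> W).
Hypothesis phiL : linear phi.

Lemma lin_fun0 : phi 0 = 0.
Proof. by have := phiL (-1) 0 0; rewrite scaler0 addr0 scaleN1r addNr. Qed.

Lemma lin_funZ k x : phi (k *: x) = k *: phi x.
Proof. by have := phiL k x 0; rewrite lin_fun0 !addr0. Qed.

Lemma lin_funD x y : phi (x + y) = phi x + phi y.
Proof. by have := phiL 1 x y; rewrite !scale1r. Qed.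

Lemma lin_funB x y : phi (x - y) = phi x - phi y.
Proof. by rewrite lin_funD -scaleN1r lin_funZ scaleN1r. Qed.
End LinearFacts.

Section FreeModule.
Variables (K : comPzRingType) (X : choiceType).

Definition finsupp : {pred X -> K^o} :=
  fun f => `[< finite_set [set x | f x != 0] >].

Lemma finsupp_submod : submod_closed finsupp.
Proof.
split=> [|k f g /asboolP fF /asboolP gF]; apply/asboolP.
  rewrite (_ : [set _ | _] = set0); first exact: finite_set0.
  by rewrite -subset0 => x /=; rewrite eqxx.
apply: (@sub_finite_set _ _ ([set x | f x != 0] `|` [set x | g x != 0])).
  move=> x /=; have [fx0 | ] := eqVneq (f x) 0; last by left.
  rewrite (_ : (k *: f + g) x = k *: f x + g x) // fx0 scaler0 add0r.
  by right.
by rewrite finite_setU.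
Qed.

HB.instance Definition _ :=
  GRing.isSubmodClosed.Build K (X -> K^o) finsupp finsupp_submod.

(* The free K-module on X.  For X = G this is the K-module underlying the
   group algebra KG. *)
Record freemod := FreeMod {
  free_coef :> X -> K^o;
  _ : free_coef \in finsupp }.

HB.instance Definition _ := [isSub for free_coef].
HB.instance Definition _ := [Choice of freemod by <:].
HB.instance Definition _ := [SubChoice_isSubLmodule of freemod by <:].

Lemma fbasis_subproof (x : X) :
  (fun y => (y == x)%:R : K^o) \in finsupp.
Proof.
apply/asboolP; apply: (@sub_finite_set _ _ [set x]); last exact: finite_set1.
by move=> y /=; have [->|] := eqVneq y x; rewrite ?eqxx.
Qed.

Definition fbasis (x : X) : freemod := FreeMod (fbasis_subproof x).

Lemma freeP (f g : freemod) : f =1 g -> f = g.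
Proof. by move=> fg; apply: val_inj; apply: funext. Qed.

Lemma freeDE (k : K) (f g : freemod) x : (k *: f + g) x = k * f x + g x.
Proof. by []. Qed.

Definition fsupp (f : freemod) : seq X := enum_fset (fset_set [set x | f x != 0]).

Lemma mem_fsupp (f : freemod) x : (x \in fsupp f) = (f x != 0).
Proof.
rewrite in_fset_set; last exact/asboolP/(valP f).
by apply/idP/idP => [/set_mem|] // H; apply/mem_set.
Qed.

Definition free_lift (W : lmodType K) (h : X -> W) (f : freemod) : W :=
  \sum_(x <- fsupp f) f x *: h x.

Lemma free_liftE (W : lmodType K) (h : X -> W) (f : freemod) (s : seq X) :
  uniq s -> {subset fsupp f <= s} ->
  free_lift h f = \sum_(x <- s) f x *: h x.
Proof.
move=> us fs; rewrite [RHS](bigID (fun x => f x != 0)) /=.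
rewrite [X in _ + X]big1 ?addr0; last first.
  by move=> x /negbNE/eqP->; rewrite scale0r.
rewrite -big_filter; apply: perm_big; apply: uniq_perm.
- exact: fset_uniq.
- exact: filter_uniq.
move=> x; rewrite mem_filter mem_fsupp; case E: (f x != 0) => //=.
by apply/esym/fs; rewrite mem_fsupp.
Qed.

Lemma free_lift_linear (W : lmodType K) (h : X -> W) : linear (free_lift h).
Proof.
move=> k f g; pose s := undup (fsupp f ++ fsupp g).
have us : uniq s by exact: undup_uniq.
rewrite !(@free_liftE _ _ _ s) //.
- rewrite scaler_sumr -big_split; apply: eq_bigr => x _.
  by rewrite freeDE scalerDl -scalerA.
- by move=> x; rewrite mem_undup mem_cat => ->; rewrite orbT.
- by move=> x; rewrite mem_undup mem_cat => ->.
- move=> x; rewrite mem_undup mem_cat !mem_fsupp freeDE.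
  by have [->|//] := eqVneq (f x) 0; rewrite mulr0 add0r.
Qed.

Lemma free_liftB (W : lmodType K) (h : X -> W) x :
  free_lift h (fbasis x) = h x.
Proof.
rewrite (@free_liftE _ _ _ [:: x]) //.
  by rewrite big_seq1 /= eqxx scale1r.
by move=> y; rewrite mem_fsupp inE /=; case: (y == x); rewrite ?eqxx.
Qed.

Lemma free_expand (f : freemod) : f = \sum_(x <- fsupp f) f x *: fbasis x.
Proof.
apply: freeP => y.
have val_sum (s : seq X) : (\sum_(x <- s) f x *: fbasis x : freemod) y =
    \sum_(x <- s) f x * (y == x)%:R.
  by elim: s => [|x s IH]; rewrite ?big_nil ?big_cons //= -IH.
rewrite val_sum; have [fy|fy] := boolP (y \in fsupp f).
  rewrite (bigD1_seq y) ?fset_uniq //= eqxx mulr1 big1 ?addr0 //.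
  by move=> x /negPf; rewrite eq_sym => ->; rewrite mulr0.
rewrite big_seq big1; first by move: fy; rewrite mem_fsupp negbK => /eqP.
move=> x xf; have [xy|] := eqVneq y x; last by rewrite mulr0.
by rewrite xy xf in fy.
Qed.

Lemma free_ind (P : freemod -> Prop) :
  P 0 -> (forall k x f, P f -> P (k *: fbasis x + f)) -> forall f, P f.
Proof.
move=> P0 PD f; rewrite (free_expand f).
by elim: (fsupp f : seq X) => [|x s IH]; rewrite ?big_nil ?big_cons //; apply: PD.
Qed.
End FreeModule.

Section QuotientModule.
Variables (K : comPzRingType) (V : lmodType K).

(* The submodule generated by S: the smallest submodule containing S. *)
Definition submod_gen (S : set V) : {pred V} := fun v =>
  `[< forall P : {pred V}, submod_closed P ->
        (forall s, S s -> s \in P) -> v \in P >].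

Lemma submod_gen_closed (S : set V) : submod_closed (submod_gen S).
Proof.
split=> [|k u v /asboolP uS /asboolP vS]; apply/asboolP => P PV SP.
  by case: PV.
by case: (PV) => _; apply; [exact: uS | exact: vS].
Qed.

HB.instance Definition _ S :=
  GRing.isSubmodClosed.Build K V (submod_gen S) (submod_gen_closed S).

Variable S : set V.

Definition quotmod : Type := Quotient.quot (submod_gen S).
HB.instance Definition _ := GRing.Zmodule.on quotmod.

Definition qclass (v : V) : quotmod := (\pi_(Quotient.quot (submod_gen S)) v)%qT.

Lemma qclass_eq u v : qclass u = qclass v <-> u - v \in submod_gen S.
Proof. by rewrite Quotient.idealrBE; split=> [/eqP|/eqP]. Qed.

Lemma qclass_surj (q : quotmod) : exists v, q = qclass v.
Proof. by exists (repr q); rewrite /qclass reprK. Qed.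

Lemma qclassD u v : qclass (u + v) = qclass u + qclass v.
Proof. exact: raddfD. Qed.

Definition qscale (k : K) (q : quotmod) : quotmod :=
  qclass (k *: repr (q : Quotient.quot (submod_gen S))).

Lemma qclassZ k v : qclass (k *: v) = qscale k (qclass v).
Proof.
apply/qclass_eq; rewrite -scalerBr rpredZ //; apply/qclass_eq.
by rewrite [RHS]/qclass reprK.
Qed.

Fact qscaleA a b q : qscale a (qscale b q) = qscale (a * b) q.
Proof. by have [v ->] := qclass_surj q; rewrite -!qclassZ scalerA. Qed.
Fact qscale1 : left_id 1 qscale.
Proof. by move=> q; have [v ->] := qclass_surj q; rewrite -!qclassZ scale1r. Qed.
Fact qscaleDr : right_distributive qscale +%R.
Proof.
move=> a p q; have [u ->] := qclass_surj p; have [v ->] := qclass_surj q.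
by rewrite -!(qclassZ, qclassD) scalerDr.
Qed.
Fact qscaleDl q : {morph qscale^~ q : a b / a + b}.
Proof.
move=> a b; have [v ->] := qclass_surj q.
by rewrite -!(qclassZ, qclassD) scalerDl.
Qed.

HB.instance Definition _ := GRing.Zmodule_isLmodule.Build K quotmod
  qscaleA qscale1 qscaleDr qscaleDl.

Lemma qclass_linear : linear qclass.
Proof. by move=> k u v; rewrite qclassD qclassZ. Qed.

(* Total, but the map induced on the quotient only when phi is linear and
   vanishes on S (quot_liftE). *)
Definition quot_lift (W : lmodType K) (phi : V -> W) (q : quotmod) : W :=
  phi (repr (q : Quotient.quot (submod_gen S))).

Lemma quot_liftE (W : lmodType K) (phi : V -> W) v :
  linear phi -> (forall s, S s -> phi s = 0) ->
  quot_lift phi (qclass v) = phi v.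
Proof.
move=> phiL phiS; rewrite /quot_lift.
have : repr (qclass v : Quotient.quot (submod_gen S)) - v \in submod_gen S.
  by apply/qclass_eq; rewrite [LHS]/qclass reprK.
move/asboolP => /(_ (fun v => phi v == 0)) H.
apply/eqP; rewrite -subr_eq0 -(lin_funB phiL); apply: H.
  split=> [|k a b /eqP a0 /eqP b0]; rewrite -topredE /= ?(lin_fun0 phiL) //.
  by rewrite phiL a0 b0 scaler0 addr0.
by move=> s Ss; rewrite -topredE /= phiS ?eqxx.
Qed.

Lemma quot_lift_linear (W : lmodType K) (phi : V -> W) :
  linear phi -> (forall s, S s -> phi s = 0) -> linear (quot_lift phi).
Proof.
move=> phiL phiS k p q; have [u ->] := qclass_surj p; have [v ->] := qclass_surj q.
by rewrite -qclass_linear !quot_liftE // phiL.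
Qed.
End QuotientModule.

Definition bilinear_map (K : comPzRingType) (U V W : lmodType K)
    (b : U -> V -> W) : Prop :=
  (forall v, linear (b^~ v)) /\ (forall u, linear (b u)).

Section TensorProduct.
Variables (K : comPzRingType) (U V : lmodType K).

Variant tensor_rel : set (freemod K (U * V)%type) :=
| TensorRelL k u u' v : tensor_rel
    (fbasis K (k *: u + u', v) - (k *: fbasis K (u, v) + fbasis K (u', v)))
| TensorRelR k u v v' : tensor_rel
    (fbasis K (u, k *: v + v') - (k *: fbasis K (u, v) + fbasis K (u, v'))).

Definition tensor : lmodType K := quotmod tensor_rel.

Definition tens (u : U) (v : V) : tensor := qclass tensor_rel (fbasis K (u, v)).

Lemma tens_bilinear : bilinear_map tens.
Proof.
split=> [v k u u'|u k v v']; rewrite /tens -qclass_linear; apply/qclass_eq.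
  by apply/asboolP => P _; apply; exact: TensorRelL.
by apply/asboolP => P _; apply; exact: TensorRelR.
Qed.

Definition tens_lift (W : lmodType K) (b : U -> V -> W) : tensor -> W :=
  quot_lift (free_lift (fun uv => b uv.1 uv.2)).

Section Lift.
Variables (W : lmodType K) (b : U -> V -> W).
Hypothesis bP : bilinear_map b.

Let lin := free_lift_linear (fun uv => b uv.1 uv.2).

Let free_lift_rel s : tensor_rel s -> free_lift (fun uv => b uv.1 uv.2) s = 0.
Proof.
have E k x y z : free_lift (fun uv => b uv.1 uv.2)
    (fbasis K x - (k *: fbasis K y + fbasis K z))
  = b x.1 x.2 - (k *: b y.1 y.2 + b z.1 z.2).
  by rewrite (lin_funB lin) lin !free_liftB.
by case: bP => b1 b2; case=> [k u u' v|k u v v']; rewrite E /= ?b1 ?b2 subrr.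
Qed.

Lemma tens_liftE u v : tens_lift b (tens u v) = b u v.
Proof. by rewrite /tens_lift quot_liftE // free_liftB. Qed.

Lemma tens_lift_linear : linear (tens_lift b).
Proof. exact: quot_lift_linear. Qed.
End Lift.

Lemma tens_ind (P : tensor -> Prop) :
  P 0 -> (forall t u v, P t -> P (tens u v + t)) -> forall t, P t.
Proof.
move=> P0 PD t; have [f ->] := qclass_surj t.
elim/free_ind: f => [|k [u v] f IH]; first by rewrite /qclass raddf0.
have -> : qclass tensor_rel (k *: fbasis K (u, v) + f)
    = tens (k *: u) v + qclass tensor_rel f.
  rewrite qclass_linear; congr (_ + _).
  by have [tl _] := tens_bilinear; rewrite (lin_funZ (tl v)).
exact: PD.
Qed.
End TensorProduct.

Section EndomorphismMonoid.
Variables (K : comPzRingType) (M : lmodType K).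

(* End_K(M), a monoid under composition. *)
Record endK := EndK { endK_fun :> M -> M; endK_linear : linear endK_fun }.

HB.instance Definition _ := gen_eqMixin endK.
HB.instance Definition _ := gen_choiceMixin endK.

Lemma endKP (f g : endK) : f =1 g -> f = g.
Proof.
case: f g => [f fL] [g gL] /= /funext fg; subst g.
by rewrite (Prop_irrelevance fL gL).
Qed.

Definition endK_one := EndK (fun (k : K) (x y : M) => erefl (k *: x + y)).

Lemma endK_mul_linear (f g : endK) : linear (f \o g).
Proof. by move=> k x y /=; rewrite !endK_linear. Qed.

Definition endK_mul f g := EndK (endK_mul_linear f g).

Fact endK_mulA : associative endK_mul.
Proof. by move=> f g h; apply: endKP. Qed.
Fact endK_mul1 : left_id endK_one endK_mul.
Proof. by move=> f; apply: endKP. Qed.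
Fact endK_1mul : right_id endK_one endK_mul.
Proof. by move=> f; apply: endKP. Qed.

HB.instance Definition _ := isMonoid.Build endK endK_mulA endK_mul1 endK_1mul.

Lemma endK1E x : (1%g : endK) x = x. Proof. by []. Qed.
Lemma endKME (f g : endK) x : (f * g)%g x = f (g x). Proof. by []. Qed.
End EndomorphismMonoid.

(* Associative algebras (not necessarily unital) and Lie algebras are treated
   uniformly; the kind also selects the matching notion of module, since a
   product may well be both associative and Lie. *)
Variant algebra_kind := Associative | Lie.

Definition algebra_axiom (kind : algebra_kind) (V : zmodType)
    (mul : V -> V -> V) : Prop :=
  match kind with
  | Associative => associative mul
  | Lie => (forall x, mul x x = 0) /\
      (forall x y z,
        mul x (mul y z) + mul y (mul z x) + mul z (mul x y) = 0)
  end.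

Record algebra (kind : algebra_kind) (K : comPzRingType) := Algebra {
  alg_mod :> lmodType K;
  amul : alg_mod -> alg_mod -> alg_mod;
  amul_bilinear : bilinear_map amul;
  amul_axiom : algebra_axiom kind amul }.

Arguments amul {kind K a}.

Definition module_action (kind : algebra_kind) (K : comPzRingType)
    (A : algebra kind K) (M : lmodType K) (act : A -> M -> M) : Prop :=
  bilinear_map act /\
  forall x y m, act (amul x y) m =
    match kind with
    | Associative => act x (act y m)
    | Lie => act x (act y m) - act y (act x m)
    end.

Section AlgebraEndomorphismMonoid.
Variables (kind : algebra_kind) (K : comPzRingType) (A : algebra kind K).

Record end0 := End0 {
  end0_endK :> endK A;
  end0M : {morph end0_endK : x y / amul x y} }.

HB.instance Definition _ := gen_eqMixin end0.
HB.instance Definition _ := gen_choiceMixin end0.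

Lemma end0P (f g : end0) : f =1 g -> f = g.
Proof.
case: f g => [f fM] [g gM] /= /endKP fg; subst g.
by rewrite (Prop_irrelevance fM gM).
Qed.

Fact end0_one_morph : {morph (1%g : endK A) : x y / amul x y}.
Proof. by []. Qed.
Definition end0_one := End0 end0_one_morph.

Fact end0_mul_morph (f g : end0) :
  {morph ((f : endK A) * (g : endK A))%g : x y / amul x y}.
Proof. by move=> x y; rewrite !endKME !end0M. Qed.
Definition end0_mul f g := End0 (end0_mul_morph f g).

Fact end0_mulA : associative end0_mul.
Proof. by move=> f g h; apply: end0P. Qed.
Fact end0_mul1 : left_id end0_one end0_mul.
Proof. by move=> f; apply: end0P. Qed.
Fact end0_1mul : right_id end0_one end0_mul.
Proof. by move=> f; apply: end0P. Qed.

HB.instance Definition _ := isMonoid.Build end0 end0_mulA end0_mul1 end0_1mul.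

Lemma end01E x : (1%g : end0) x = x. Proof. by []. Qed.
Lemma end0ME (f g : end0) x : (f * g)%g x = f (g x). Proof. by []. Qed.
End AlgebraEndomorphismMonoid.

Definition partial_rep (G : groupType) (S : monoidType) (pi : G -> S) : Prop :=
  [/\ pi 1%g = 1%g,
      forall g h, (pi g^-1 * pi g * pi h = pi g^-1 * pi (g * h))%g
    & forall g h, (pi g * pi h * pi h^-1 = pi (g * h) * pi h^-1)%g].

Definition is_ideal (kind : algebra_kind) (K : comPzRingType)
    (A : algebra kind K) (I : set A) : Prop :=
  [/\ I 0,
      forall (k : K) x y, I x -> I y -> I (k *: x + y)
    & forall a x, I x -> I (amul a x) /\ I (amul x a)].

Record ideal_partial_rep (G : groupType) (kind : algebra_kind)
    (K : comPzRingType) (A : algebra kind K) := IdealPartialRep {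
  ipr_fun :> G -> end0 A;
  ipr_rep : partial_rep ipr_fun;
  ipr_ideal : forall g, is_ideal (range (ipr_fun g)) }.

Definition covariant_rep (G : groupType) (kind : algebra_kind)
    (K : comPzRingType) (A : algebra kind K) (lam : ideal_partial_rep G A)
    (M : lmodType K) (act : A -> M -> M) (pi : G -> endK M) : Prop :=
  let eps g := (pi g * pi g^-1)%g in
  let e g := (lam g * lam g^-1)%g in
  [/\ module_action act,
      partial_rep pi,
      forall g x m, pi g (act x m) = act (lam g x) (pi g m)
    & forall g x m, eps g (act x m) = act (e g x) m /\
                    act (e g x) m = act x (eps g m)].

Section Lambda.
Variables (K : comPzRingType) (G : groupType) (N : lmodType K).
Variable rho : G -> endK N.

Variant Lambda_rel : set (tensor (freemod K G) N) :=
| LambdaRel g h n of range (rho h^-1%g) n : Lambda_rel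
    (tens (fbasis K g) (rho h n) - tens (fbasis K (g * h)%g) n).

Definition Lambda : lmodType K := quotmod Lambda_rel.

Definition lclass (g : G) (n : N) : Lambda :=
  qclass Lambda_rel (tens (fbasis K g) n).

Lemma lclass_linear g : linear (lclass g).
Proof.
move=> k m n; rewrite /lclass -qclass_linear.
by have [_ ->] := tens_bilinear (freemod K G) N.
Qed.

Lemma lclass_rel g h n : lclass g (rho h (rho h^-1%g n)) =
  lclass (g * h)%g (rho h^-1%g n).
Proof.
apply/qclass_eq/asboolP => P _; apply.
by constructor; exists n.
Qed.

Lemma Lambda_ind (P : Lambda -> Prop) :
  P 0 -> (forall X g n, P X -> P (lclass g n + X)) -> forall X, P X.
Proof.
move=> P0 PD X; have [t ->] := qclass_surj X.
elim/tens_ind: t => [|t a n IH]; first by rewrite /qclass raddf0.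
elim/free_ind: a n t IH => [|k g a IHa] n t Pt.
  have [tl _] := tens_bilinear (freemod K G) N.
  by rewrite (lin_fun0 (tl n)) add0r.
have [tl tr] := tens_bilinear (freemod K G) N.
have -> : tens (k *: fbasis K g + a) n + t =
    tens (fbasis K g) (k *: n) + (tens a n + t).
  by rewrite tl (lin_funZ (tr (fbasis K g))) addrA.
by rewrite qclassD; apply: PD; apply: IHa.
Qed.

(* The linear map [g, n] |-> f g n when f respects the relations
   (Lambda_liftE). *)
Definition Lambda_lift (W : lmodType K) (f : G -> N -> W) : Lambda -> W :=
  quot_lift (tens_lift (fun a n => free_lift (f^~ n) a)).

Section Lift.
Variables (W : lmodType K) (f : G -> N -> W).
Hypothesis fL : forall g, linear (f g).
Hypothesis f_rel : forall g h n,
  f g (rho h (rho h^-1%g n)) = f (g * h)%g (rho h^-1%g n).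

Let f_bilinear : bilinear_map (fun a n => free_lift (f^~ n) a).
Proof.
split=> [n|a k m n]; first exact: free_lift_linear.
rewrite /free_lift scaler_sumr -big_split; apply: eq_bigr => g _ /=.
by rewrite fL scalerDr !scalerA mulrC.
Qed.

Let lift_rel s : Lambda_rel s -> tens_lift (fun a n => free_lift (f^~ n) a) s = 0.
Proof.
case=> g h n [m _ <-]; rewrite (lin_funB (tens_lift_linear f_bilinear)).
by rewrite !(tens_liftE f_bilinear) !free_liftB f_rel subrr.
Qed.

Lemma Lambda_liftE g n : Lambda_lift f (lclass g n) = f g n.
Proof.
rewrite /Lambda_lift quot_liftE ?tens_liftE ?free_liftB //.
exact: tens_lift_linear.
Qed.

Lemma Lambda_lift_linear : linear (Lambda_lift f).
Proof. by apply: quot_lift_linear => //; exact: tens_lift_linear. Qed.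
End Lift.
End Lambda.

Section GeneratedAlgebra.
Variables (K : comPzRingType) (V : lmodType K) (m : V -> V -> V) (S : set V).
Hypothesis mP : bilinear_map m.
Hypothesis S_ind : forall P : V -> Prop,
  P 0 -> (forall x s, S s -> P x -> P (s + x)) -> forall x, P x.

Let m0l y : m 0 y = 0. Proof. exact: lin_fun0 (mP.1 y). Qed.
Let m0r x : m x 0 = 0. Proof. exact: lin_fun0 (mP.2 x). Qed.
Let mDl x x' y : m (x + x') y = m x y + m x' y.
Proof. exact: lin_funD (mP.1 y) _ _. Qed.
Let mDr x y y' : m x (y + y') = m x y + m x y'.
Proof. exact: lin_funD (mP.2 x) _ _. Qed.

Lemma gen_assoc :
  (forall x y z, S x -> S y -> S z -> m x (m y z) = m (m x y) z) ->
  associative m.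
Proof.
move=> mA; elim/S_ind => [|X x Sx IHX] Y Z; first by rewrite !m0l.
rewrite !mDl -IHX; congr (_ + _).
elim/S_ind: Y => [|Y y Sy IHY]; first by rewrite !(m0l, m0r).
rewrite !(mDl, mDr) -IHY; congr (_ + _).
elim/S_ind: Z {IHY} => [|Z z Sz IHZ]; first by rewrite !m0r.
by rewrite !mDr -IHZ mA.
Qed.

Lemma gen_anti : (forall x y, S x -> S y -> m x y = - m y x) ->
  forall x y, m x y = - m y x.
Proof.
move=> mN X Y.
elim/S_ind: X => [|X x Sx IHX]; first by rewrite m0l m0r oppr0.
rewrite mDl mDr opprD -IHX; congr (_ + _).
elim/S_ind: Y {IHX} => [|Y y Sy IHY]; first by rewrite m0l m0r oppr0.
by rewrite mDl mDr opprD -IHY mN.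
Qed.

Lemma gen_alt : (forall x y, m x y = - m y x) ->
  (forall x, S x -> m x x = 0) -> forall x, m x x = 0.
Proof.
move=> mN mx; elim/S_ind => [|X x Sx IHX]; first by rewrite m0l.
by rewrite mDl !mDr IHX mx // (mN X x) add0r addr0 subrr.
Qed.

Let add0s (a b c a' b' c' : V) : a + b + c = 0 -> a' + b' + c' = 0 ->
  (a + a') + (b + b') + (c + c') = 0.
Proof.
by move=> e e'; rewrite (addrACA a a') (addrACA (a + b)) e e' addr0.
Qed.

Lemma gen_jacobi :
  (forall x y z, S x -> S y -> S z ->
     m x (m y z) + m y (m z x) + m z (m x y) = 0) ->
  forall x y z, m x (m y z) + m y (m z x) + m z (m x y) = 0.
Proof.
move=> mJ; elim/S_ind => [|X x Sx IHX] Y Z.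
  by rewrite !(m0l, m0r) !addr0.
rewrite !(mDl, mDr); apply: add0s (IHX _ _).
elim/S_ind: Y => [|Y y Sy IHY]; first by rewrite !(m0l, m0r) !addr0.
rewrite !(mDl, mDr); apply: add0s IHY.
elim/S_ind: Z => [|Z z Sz IHZ]; first by rewrite !(m0l, m0r) !addr0.
by rewrite !(mDl, mDr); apply: add0s IHZ; apply: mJ.
Qed.
End GeneratedAlgebra.

Section LambdaAlgebra.
Variables (G : groupType) (kind : algebra_kind) (K : comPzRingType).
Variables (A : algebra kind K) (lam : ideal_partial_rep G A).
Implicit Types (g h k : G) (x y z : A).

Definition lam_endK g : endK A := lam g.

Local Notation LA := (Lambda lam_endK).
Local Notation cls := (lclass lam_endK).

Lemma ipr1 x : lam 1%g x = x.
Proof. by have [-> _ _] := ipr_rep lam. Qed.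

Lemma iprL g h x : lam g^-1%g (lam g (lam h x)) = lam g^-1%g (lam (g * h)%g x).
Proof.
have [_ H _] := ipr_rep lam.
by have := congr1 (fun f : end0 A => f x) (H g h); rewrite !end0ME.
Qed.

Lemma iprR g h x : lam g (lam h (lam h^-1%g x)) = lam (g * h)%g (lam h^-1%g x).
Proof.
have [_ _ H] := ipr_rep lam.
by have := congr1 (fun f : end0 A => f x) (H g h); rewrite !end0ME.
Qed.

Lemma iprVL g h x : lam g (lam g^-1%g (lam h x)) = lam g (lam (g^-1 * h)%g x).
Proof. by have := iprL g^-1%g h x; rewrite invgK. Qed.

Lemma iprVR g h x :
  lam g (lam h^-1%g (lam h x)) = lam (g * h^-1)%g (lam h x).
Proof. by have := iprR g h^-1%g x; rewrite invgK. Qed.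

Lemma iprK g x : lam g (lam g^-1%g (lam g x)) = lam g x.
Proof. by rewrite iprVR mulgV ipr1. Qed.

Lemma ipr_range g x :
  range (lam g) x -> lam g (lam g^-1%g x) = x.
Proof. by case=> y _ <-; rewrite iprK. Qed.

Lemma ipr_rangeM g x y : range (lam g) x ->
  range (lam g) (amul x y) /\ range (lam g) (amul y x).
Proof. by have [_ _ H] := ipr_ideal lam g => /(H y) []. Qed.

Lemma ipr_absorbr g x y : range (lam g) x ->
  amul x (lam g (lam g^-1%g y)) = amul x y.
Proof.
move=> xg; have [xyg _] := ipr_rangeM y xg.
by rewrite -(ipr_range xyg) !end0M (ipr_range xg).
Qed.

Lemma ipr_absorbl g x y : range (lam g) x ->
  amul (lam g (lam g^-1%g y)) x = amul y x.
Proof.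
move=> xg; have [_ yxg] := ipr_rangeM y xg.
by rewrite -(ipr_range yxg) !end0M (ipr_range xg).
Qed.

Let amulL y : linear (amul^~ y) := (amul_bilinear A).1 y.
Let amulR x : linear (amul x) := (amul_bilinear A).2 x.

Definition Lmulr g x : LA -> LA :=
  Lambda_lift (fun h y => cls g (amul x (lam (g^-1 * h)%g y))).

Let Lmulr_rel g x h k y :
  cls g (amul x (lam (g^-1 * h)%g (lam k (lam k^-1%g y)))) =
  cls g (amul x (lam (g^-1 * (h * k))%g (lam k^-1%g y))).
Proof. by rewrite iprR mulgA. Qed.

Let Lmulr_lin g x h : linear (fun y => cls g (amul x (lam (g^-1 * h)%g y))).
Proof. by move=> a y z; rewrite endK_linear amulR lclass_linear. Qed.

Lemma LmulrE g x h y : Lmulr g x (cls h y) = cls g (amul x (lam (g^-1 * h)%g y)).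
Proof. exact: Lambda_liftE (Lmulr_lin g x) (Lmulr_rel g x) h y. Qed.

Lemma Lmulr_linear g x : linear (Lmulr g x).
Proof. exact: Lambda_lift_linear (Lmulr_lin g x) (Lmulr_rel g x). Qed.

Definition Lambda_mul (X Y : LA) : LA := Lambda_lift (fun g x => Lmulr g x Y) X.

Let Lmul_lin Y g : linear (fun x => Lmulr g x Y).
Proof.
move=> a x y; elim/Lambda_ind: Y => [|Y h z IH].
  by rewrite !(lin_fun0 (Lmulr_linear _ _)) scaler0 addr0.
rewrite !(lin_funD (Lmulr_linear _ _)) IH !LmulrE amulL lclass_linear.
by rewrite scalerDr addrACA.
Qed.

Let Lmul_rel Y g h x :
  Lmulr g (lam h (lam h^-1%g x)) Y = Lmulr (g * h)%g (lam h^-1%g x) Y.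
Proof.
elim/Lambda_ind: Y => [|Y k y IH].
  by rewrite !(lin_fun0 (Lmulr_linear _ _)).
rewrite !(lin_funD (Lmulr_linear _ _)) {}IH !LmulrE; congr (_ + _).
rewrite invgM -mulgA; set a := (g^-1 * k)%g.
have xr : range (lam h^-1%g) (lam h^-1%g x) by exists x.
have [/ipr_range <- _] := ipr_rangeM (lam (h^-1 * a)%g y) xr.
rewrite invgK -(lclass_rel lam_endK) /lam_endK.
rewrite !end0M; have := iprVL h a y; rewrite /a => <-.
by rewrite iprK !ipr_absorbr; try exists (lam h^-1%g x).
Qed.

Lemma Lambda_mulE g x h y :
  Lambda_mul (cls g x) (cls h y) = cls g (amul x (lam (g^-1 * h)%g y)).
Proof.
by rewrite [LHS](Lambda_liftE (Lmul_lin _) (Lmul_rel _)) LmulrE.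
Qed.

Lemma Lambda_mul_bilinear : bilinear_map Lambda_mul.
Proof.
split=> [Y|X]; first exact: Lambda_lift_linear (Lmul_lin Y) (Lmul_rel Y).
move=> a Y Z; elim/Lambda_ind: X => [|X g x IH].
  have L0 T : Lambda_mul 0 T = 0.
    exact: lin_fun0 (Lambda_lift_linear (Lmul_lin T) (Lmul_rel T)).
  by rewrite !L0 scaler0 addr0.
have LD T : Lambda_mul (cls g x + X) T = Lmulr g x T + Lambda_mul X T.
  rewrite [LHS](lin_funD (Lambda_lift_linear (Lmul_lin T) (Lmul_rel T))).
  by congr (_ + _); rewrite (Lambda_liftE (Lmul_lin T) (Lmul_rel T)).
by rewrite !LD IH Lmulr_linear scalerDr addrACA.
Qed.

Lemma Lambda_mulE2 g x h y :
  Lambda_mul (cls g x) (cls h y) = cls h (amul (lam (h^-1 * g)%g x) y).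
Proof.
rewrite Lambda_mulE; set a := (g^-1 * h)%g.
have ar : range (lam a) (lam a y) by exists y.
have [_ /ipr_range <-] := ipr_rangeM x ar.
have := lclass_rel lam_endK g a (amul x (lam a y)); rewrite /lam_endK => ->.
have -> : (g * a)%g = h by rewrite /a mulgA mulgV mul1g.
have aV : (a^-1 = h^-1 * g)%g by rewrite invgM invgK.
rewrite end0M -aV; congr (cls h _).
have := @ipr_absorbr a^-1%g (lam a^-1%g x) y; rewrite invgK; apply.
by exists x.
Qed.

Let LmL Y : linear (Lambda_mul^~ Y) := Lambda_mul_bilinear.1 Y.
Let LmR X : linear (Lambda_mul X) := Lambda_mul_bilinear.2 X.

Let amul_shift g h k y z :
  amul (lam (g^-1 * h)%g y) (lam (g^-1 * h)%g (lam (h^-1 * k)%g z)) =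
  amul (lam (g^-1 * h)%g y) (lam (g^-1 * k)%g z).
Proof.
have yr : range (lam (g^-1 * h)%g) (lam (g^-1 * h)%g y) by exists y.
rewrite -[RHS](ipr_absorbr _ yr) iprVL.
by rewrite invgM invgK -mulgA [(g * _)%g]mulgA mulgV mul1g.
Qed.

Let Lambda_mulA3 g x h y k z :
  Lambda_mul (cls g x) (Lambda_mul (cls h y) (cls k z)) =
  cls g (amul x (amul (lam (g^-1 * h)%g y) (lam (g^-1 * k)%g z))).
Proof. by rewrite !Lambda_mulE end0M amul_shift. Qed.

Let gens : set LA := [set X | exists g x, X = cls g x].

Let gens_ind (P : LA -> Prop) :
  P 0 -> (forall X Y, gens Y -> P X -> P (Y + X)) -> forall X, P X.
Proof.
move=> P0 PD; apply: Lambda_ind => // X g x PX.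
by apply: PD => //; exists g, x.
Qed.

Let cls0 g : cls g 0 = 0.
Proof. exact: lin_fun0 (lclass_linear lam_endK g). Qed.

Let clsN g x : cls g (- x) = - cls g x.
Proof. by rewrite -sub0r (lin_funB (lclass_linear lam_endK g)) cls0 sub0r. Qed.

Let Lambda_assoc : associative (@amul _ _ A) -> associative Lambda_mul.
Proof.
move=> asA; apply: (gen_assoc Lambda_mul_bilinear gens_ind).
move=> _ _ _ [g [x ->]] [h [y ->]] [k [z ->]].
by rewrite Lambda_mulA3 asA !Lambda_mulE.
Qed.

Section LieCase.
Hypothesis amulxx : forall x, amul x x = 0.
Hypothesis jacobi : forall x y z,
  amul x (amul y z) + amul y (amul z x) + amul z (amul x y) = 0.

Let amulN x y : amul x y = - amul y x.
Proof.
apply/eqP; rewrite -addr_eq0; apply/eqP.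
have := amulxx (x + y); rewrite (lin_funD (amulR _)) !(lin_funD (amulL _)).
by rewrite !amulxx add0r addr0 addrC.
Qed.

Let Lambda_mulN X Y : Lambda_mul X Y = - Lambda_mul Y X.
Proof.
apply: (gen_anti Lambda_mul_bilinear gens_ind) => _ _ [g [x ->]] [h [y ->]].
by rewrite Lambda_mulE Lambda_mulE2 amulN clsN.
Qed.

Lemma Lambda_lie : algebra_axiom Lie Lambda_mul.
Proof.
split.
  apply: (gen_alt Lambda_mul_bilinear gens_ind Lambda_mulN) => _ [g [x ->]].
  by rewrite Lambda_mulE mulVg ipr1 amulxx cls0.
apply: (gen_jacobi Lambda_mul_bilinear gens_ind).
move=> _ _ _ [g [x ->]] [h [y ->]] [k [z ->]].
rewrite Lambda_mulA3.
rewrite (Lambda_mulE2 k z g x) (Lambda_mulE2 h y).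
rewrite (Lambda_mulE g x h y) (Lambda_mulE2 k z).
rewrite -!(lin_funD (lclass_linear lam_endK g)).
by rewrite jacobi cls0.
Qed.
End LieCase.

Lemma Lambda_algebra_axiom : algebra_axiom kind Lambda_mul.
Proof.
have : forall t, algebra_axiom t (@amul _ _ A) -> algebra_axiom t Lambda_mul.
  by case=> [|[]]; [exact: Lambda_assoc | exact: Lambda_lie].
by apply; exact: amul_axiom.
Qed.

Definition Lambda_alg : algebra kind K :=
  Algebra Lambda_mul_bilinear Lambda_algebra_axiom.

Lemma Lambda_algE g x h y :
  @amul _ _ Lambda_alg (cls g x) (cls h y) =
  cls g (amul x (lam (g^-1 * h)%g y)).
Proof. exact: Lambda_mulE. Qed.
End LambdaAlgebra.

(* Main.v *)
Require Import Defs.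
From HB Require Import structures.
From mathcomp Require Import all_boot all_order all_algebra.

(** Write [g, n] for the class of g (x) n, eps_g = pi_g pi_{g^-1} and
    e_g = lambda_g lambda_{g^-1}.  In Lambda(M) an element of im pi_h can be
    transported from the index g to the index gh by applying pi_{h^-1}, and
    this is the only relation.  Covariance makes this compatible with the
    action of A, because multiplication by an element y of im lambda_h hides
    the failure of pi to be multiplicative: since y = e_h(y), one has
    y n = y (eps_h n) = eps_h (y n).  Two facts follow.

    - y n lies in im pi_h, so the class [g, y n] can be transported to the
      index gh ([lclass_slide]).
    - Inside y (-), the operators pi_h pi_a and pi_{ha} agree, since they agree
      after composition with eps_h ([act_pi_mul]).

    These make [g, x][h, m] := [g, x pi_{g^-1 h}(m)] independent of the
    representative of [g, x]; independence of that of [h, m] is the axiom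
    pi_b pi_k pi_{k^-1} = pi_{bk} pi_{k^-1}.  For the alternative formula put
    a = g^-1 h: the element x pi_a(m) lies in im pi_a, being equal to
    x (eps_a (pi_a m)) = eps_a (x pi_a m), so it can be transported to the index
    ga = h, where it becomes lambda_{a^-1}(x) m ([lclass_act_pi]).

    The module axiom is trilinear, so it suffices to check it on classes.
    There everything is brought to the index g of the first factor: by
    [act_pi_mul], [g, x]([h, y][k, m]) = [g, x (lambda_{g^-1 h}(y)
    pi_{g^-1 k}(m))], while the alternative formula turns [h, y]([g, x][k, m])
    into [g, lambda_{g^-1 h}(y) (x pi_{g^-1 k}(m))].  So the axiom for Lambda(M)
    is the axiom for M applied to x, lambda_{g^-1 h}(y) and pi_{g^-1 k}(m). *)

Set Implicit Arguments.
Unset Strict Implicit.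
Unset Printing Implicit Defensive.

Import GRing.Theory.
Local Open Scope ring_scope.

(** * Linear maps *)

Section LinearMaps.
Variables (K : comPzRingType) (U V W : lmodType K).

Lemma linear_comp (f : V -> W) (g : U -> V) :
  linear f -> linear g -> linear (fun u => f (g u)).
Proof. by move=> fL gL k u v; rewrite gL fL. Qed.

Lemma linear_sub (f g : V -> W) :
  linear f -> linear g -> linear (fun v => f v - g v).
Proof. by move=> fL gL k u v; rewrite fL gL scalerBr opprD addrACA. Qed.
End LinearMaps.

Section LambdaExtensionality.
Variables (K : comPzRingType) (G : groupType) (N : lmodType K).
Variables (rho : G -> endK N) (W : lmodType K).

Lemma Lambda_ext (f f' : Lambda rho -> W) : linear f -> linear f' ->
  (forall g n, f (lclass rho g n) = f' (lclass rho g n)) -> f =1 f'.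
Proof.
move=> fL fL' ff'; elim/Lambda_ind => [|X g n IH].
  by rewrite (lin_fun0 fL) (lin_fun0 fL').
by rewrite (lin_funD fL) (lin_funD fL') ff' IH.
Qed.
End LambdaExtensionality.

(** * Covariant representations and transport between indices *)

Section CovariantAction.
Variables (K : comPzRingType) (G : groupType) (kind : algebra_kind).
Variables (A : algebra kind K) (lam : ideal_partial_rep G A).
Variables (M : lmodType K) (act : A -> M -> M) (pi : G -> endK M).
Hypothesis covpi : covariant_rep lam act pi.
Implicit Types (g h k a : G) (x y : A) (m n : M).

Lemma act_module : module_action act. Proof. by case: covpi. Qed.

Let actL m : linear (act^~ m) := act_module.1.1 m.
Let actR x : linear (act x) := act_module.1.2 x.

Lemma pi_act g x m : pi g (act x m) = act (lam g x) (pi g m).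
Proof. by case: covpi. Qed.

Lemma eps_act g x m :
  pi g (pi g^-1%g (act x m)) = act x (pi g (pi g^-1%g m)).
Proof. by case: covpi => _ _ _ /(_ g x m) [] /= -> ->. Qed.

Lemma act_eps g x m :
  act x (pi g (pi g^-1%g m)) = act (lam g (lam g^-1%g x)) m.
Proof. by case: covpi => _ _ _ /(_ g x m) [] _ /= ->. Qed.

Lemma piL g h m : pi g^-1%g (pi g (pi h m)) = pi g^-1%g (pi (g * h)%g m).
Proof.
by case: covpi => _ [_ H _] _ _; have := congr1 (fun f : endK M => f m) (H g h).
Qed.

Lemma piR g h m : pi g (pi h (pi h^-1%g m)) = pi (g * h)%g (pi h^-1%g m).
Proof.
by case: covpi => _ [_ _ H] _ _; have := congr1 (fun f : endK M => f m) (H g h).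
Qed.

Lemma piK g m : pi g (pi g^-1%g (pi g m)) = pi g m.
Proof.
have := piR g g^-1%g m; rewrite invgK mulgV => ->.
by case: covpi => _ [-> _ _].
Qed.

(** A factor in im lambda_h absorbs the idempotent eps_h. *)
Lemma act_lam_eps h y n :
  act (lam h y) (pi h (pi h^-1%g n)) = act (lam h y) n.
Proof. by rewrite act_eps iprK. Qed.

(** Both sides may be premultiplied by eps_h, after which the axiom
    pi_{h^-1} pi_h pi_a = pi_{h^-1} pi_{ha} identifies them. *)
Lemma act_pi_mul h a y m :
  act (lam h y) (pi h (pi a m)) = act (lam h y) (pi (h * a)%g m).
Proof. by rewrite -[LHS]act_lam_eps piL act_lam_eps. Qed.

(** The relations of Lambda(M) for arbitrary elements of im pi_h, which are
    the fixed points of eps_h. *)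
Lemma lclass_transport g h n : pi h (pi h^-1%g n) = n ->
  lclass pi g n = lclass pi (g * h)%g (pi h^-1%g n).
Proof. by move=> {1}<-; exact: lclass_rel. Qed.

Lemma lclass_slide g h y n :
  lclass pi g (act (lam h y) n)
  = lclass pi (g * h)%g (act (lam h^-1%g (lam h y)) (pi h^-1%g n)).
Proof.
rewrite (@lclass_transport g h); last by rewrite eps_act act_lam_eps.
by rewrite pi_act.
Qed.

(** The element x pi_a(m) with a = g^-1 h is fixed by eps_a, because eps_a
    commutes with the action of x; so it can be transported from g to h. *)
Lemma lclass_act_pi g h x m :
  lclass pi g (act x (pi (g^-1 * h)%g m)) =
  lclass pi h (act (lam (h^-1 * g)%g x) m).
Proof.
set a := (g^-1 * h)%g.
have -> : (h^-1 * g = a^-1)%g by rewrite /a invgM invgK.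
rewrite (@lclass_transport g a); last by rewrite eps_act piK.
have -> : (g * a)%g = h by rewrite /a mulgA mulgV mul1g.
by have := act_lam_eps a^-1%g x m; rewrite pi_act invgK => ->.
Qed.

(** * The action of Lambda(A) on Lambda(M) *)

Local Notation LA := (Lambda (lam_endK lam)).
Local Notation LM := (Lambda pi).

Definition class_act g x : LM -> LM :=
  Lambda_lift (fun h m => lclass pi g (act x (pi (g^-1 * h)%g m))).

Let class_act_lin g x h :
  linear (fun m => lclass pi g (act x (pi (g^-1 * h)%g m))).
Proof. by move=> k m n; rewrite endK_linear actR lclass_linear. Qed.

Let class_act_rel g x h k m :
  lclass pi g (act x (pi (g^-1 * h)%g (pi k (pi k^-1%g m)))) =
  lclass pi g (act x (pi (g^-1 * (h * k))%g (pi k^-1%g m))).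
Proof. by rewrite piR mulgA. Qed.

Lemma class_actE g x h m :
  class_act g x (lclass pi h m) = lclass pi g (act x (pi (g^-1 * h)%g m)).
Proof. exact: Lambda_liftE (class_act_lin g x) (class_act_rel g x) h m. Qed.

Lemma class_act_linear g x : linear (class_act g x).
Proof. exact: Lambda_lift_linear (class_act_lin g x) (class_act_rel g x). Qed.

Definition Lambda_act (X : LA) (Y : LM) : LM :=
  Lambda_lift (fun g x => class_act g x Y) X.

Let Lambda_act_lin Y g : linear (fun x => class_act g x Y).
Proof.
move=> k x y; elim/Lambda_ind: Y => [|Y h m IH].
  by rewrite !(lin_fun0 (class_act_linear _ _)) scaler0 addr0.
rewrite !(lin_funD (class_act_linear _ _)) IH !class_actE actL lclass_linear.
by rewrite scalerDr addrACA.
Qed.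

(** Independence of the representative in Lambda(A).  With y = lambda_{h^-1}(x),
    sliding along h turns the left side into a class at gh with factor
    lambda_{h^-1} lambda_h (y) = y, which lies in im lambda_{h^-1}; so
    [act_pi_mul] applies to it. *)
Let Lambda_act_rel Y g h x :
  class_act g (lam_endK lam h (lam_endK lam h^-1%g x)) Y =
  class_act (g * h)%g (lam_endK lam h^-1%g x) Y.
Proof.
move: Y; apply: Lambda_ext => [||k m]; try exact: class_act_linear.
rewrite !class_actE lclass_slide /lam_endK.
have := iprK lam h^-1%g x; rewrite invgK => ->.
by rewrite act_pi_mul invgM mulgA.
Qed.

Lemma Lambda_act_class g x Y :
  Lambda_act (lclass (lam_endK lam) g x) Y = class_act g x Y.
Proof. exact: Lambda_liftE (Lambda_act_lin Y) (Lambda_act_rel Y) g x. Qed.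

Lemma Lambda_actE g x h m :
  Lambda_act (lclass (lam_endK lam) g x) (lclass pi h m) =
  lclass pi g (act x (pi (g^-1 * h)%g m)).
Proof. by rewrite Lambda_act_class class_actE. Qed.

Lemma Lambda_actE2 g x h m :
  Lambda_act (lclass (lam_endK lam) g x) (lclass pi h m) =
  lclass pi h (act (lam (h^-1 * g)%g x) m).
Proof. by rewrite Lambda_actE lclass_act_pi. Qed.

Lemma Lambda_act_bilinear : bilinear_map Lambda_act.
Proof.
have actlL Y : linear (Lambda_act^~ Y).
  exact: Lambda_lift_linear (Lambda_act_lin Y) (Lambda_act_rel Y).
split=> // X k Y Z; elim/Lambda_ind: X => [|X g x IH].
  by rewrite !(lin_fun0 (actlL _)) scaler0 addr0.
rewrite !(lin_funD (actlL _)) IH !Lambda_act_class class_act_linear.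
by rewrite scalerDr addrACA.
Qed.

(** * The module axiom *)

Let LactL Y : linear (Lambda_act^~ Y) := Lambda_act_bilinear.1 Y.
Let LactR X : linear (Lambda_act X) := Lambda_act_bilinear.2 X.

Lemma Lambda_act_act g x h y k m :
  Lambda_act (lclass (lam_endK lam) g x)
    (Lambda_act (lclass (lam_endK lam) h y) (lclass pi k m)) =
  lclass pi g (act x (act (lam (g^-1 * h)%g y) (pi (g^-1 * k)%g m))).
Proof.
rewrite !Lambda_actE pi_act act_pi_mul.
by rewrite -mulgA [(h * _)%g]mulgA mulgV mul1g.
Qed.

(** Computing the outer action by the alternative formula leaves the result at
    the index g of the inner factor, as needed to compare it with
    [Lambda_act_act] in the Lie case. *)
Lemma Lambda_act_act2 g x h y k m :
  Lambda_act (lclass (lam_endK lam) h y)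
    (Lambda_act (lclass (lam_endK lam) g x) (lclass pi k m)) =
  lclass pi g (act (lam (g^-1 * h)%g y) (act x (pi (g^-1 * k)%g m))).
Proof. by rewrite Lambda_actE Lambda_actE2. Qed.

Lemma Lambda_trilinear_ext (T T' : LA -> LA -> LM -> LM) :
  (forall Y Z, linear (fun X => T X Y Z)) ->
  (forall X Z, linear (fun Y => T X Y Z)) -> (forall X Y, linear (T X Y)) ->
  (forall Y Z, linear (fun X => T' X Y Z)) ->
  (forall X Z, linear (fun Y => T' X Y Z)) -> (forall X Y, linear (T' X Y)) ->
  (forall g x h y k m,
     T (lclass _ g x) (lclass _ h y) (lclass _ k m) =
     T' (lclass _ g x) (lclass _ h y) (lclass _ k m)) ->
  forall X Y Z, T X Y Z = T' X Y Z.
Proof.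
move=> T1 T2 T3 T1' T2' T3' TT' X Y Z.
apply: (Lambda_ext (T1 Y Z) (T1' Y Z)) => g x.
apply: (Lambda_ext (T2 _ Z) (T2' _ Z)) => h y.
by apply: (Lambda_ext (T3 _ _) (T3' _ _)) => k m.
Qed.

Lemma Lambda_act_module :
  @module_action kind K (Lambda_alg lam) LM Lambda_act.
Proof.
have [_ actM] := act_module.
have mulL Y : linear ((@Lambda_mul _ _ _ _ lam)^~ Y) :=
  (Lambda_mul_bilinear lam).1 Y.
have mulR X : linear (@Lambda_mul _ _ _ _ lam X) :=
  (Lambda_mul_bilinear lam).2 X.
split=> [|X Y Z /=]; first exact: Lambda_act_bilinear.
have linA1 X2 W : linear (fun X1 => Lambda_act X1 (Lambda_act X2 W)).
  exact: LactL.
have linA2 X1 W : linear (fun X2 => Lambda_act X1 (Lambda_act X2 W)).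
  exact: linear_comp (LactR X1) (LactL W).
have linA3 X1 X2 : linear (fun W => Lambda_act X1 (Lambda_act X2 W)).
  exact: linear_comp (LactR X1) (LactR X2).
have linM1 Y1 W : linear (fun X1 => Lambda_act (Lambda_mul X1 Y1) W).
  exact: linear_comp (LactL W) (mulL Y1).
have linM2 X1 W : linear (fun Y1 => Lambda_act (Lambda_mul X1 Y1) W).
  exact: linear_comp (LactL W) (mulR X1).
(* The kind is a separate argument of T because A, and hence the types of the
   maps below, depend on the ambient one. *)
pose T t X1 Y1 W := match t with
  | Associative => Lambda_act X1 (Lambda_act Y1 W)
  | Lie => Lambda_act X1 (Lambda_act Y1 W) - Lambda_act Y1 (Lambda_act X1 W)
  end.
have T1 t Y1 W : linear (fun X1 => T t X1 Y1 W).
  by case: t; [exact: linA1 | exact: linear_sub (linA1 Y1 W) (linA2 Y1 W)].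
have T2 t X1 W : linear (fun Y1 => T t X1 Y1 W).
  by case: t; [exact: linA2 | exact: linear_sub (linA2 X1 W) (linA1 X1 W)].
have T3 t X1 Y1 : linear (T t X1 Y1).
  by case: t; [exact: linA3 | exact: linear_sub (linA3 X1 Y1) (linA3 Y1 X1)].
have TE t g x h y k m :
    T t (lclass _ g x) (lclass _ h y) (lclass pi k m) = lclass pi g
      (let y' := lam (g^-1 * h)%g y in let m' := pi (g^-1 * k)%g m in
       match t with
       | Associative => act x (act y' m')
       | Lie => act x (act y' m') - act y' (act x m')
       end).
  case: t => /=; first exact: Lambda_act_act.
  by rewrite Lambda_act_act Lambda_act_act2 (lin_funB (lclass_linear pi g)).
rewrite -/(T kind X Y Z).
apply: (Lambda_trilinear_ext linM1 linM2 _ (T1 kind) (T2 kind) (T3 kind)).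
  by move=> X1 Y1; exact: LactR.
by move=> g x h y k m; rewrite Lambda_mulE Lambda_actE actM TE.
Qed.
End CovariantAction.

Local Open Scope group_scope.

Theorem proposition3p4 (K : comPzRingType) (G : groupType)
    (kind : algebra_kind) (A : algebra kind K) (lam : ideal_partial_rep G A)
    (M : lmodType K) (act : A -> M -> M) (pi : G -> endK M)
    (covpi : covariant_rep lam act pi) :
  exists Lact : Lambda_alg lam -> Lambda pi -> Lambda pi,
    [/\ module_action Lact,
        forall (g h : G) (x : A) (m : M),
          Lact (lclass (lam_endK lam) g x) (lclass pi h m)
          = lclass pi g (act x (pi (g^-1 * h) m))
      & forall (g h : G) (x : A) (m : M),
          Lact (lclass (lam_endK lam) g x) (lclass pi h m)
          = lclass pi h (act (lam (h^-1 * g) x) m)].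
Proof.
exists (@Lambda_act _ _ _ _ lam _ act pi); split.
- exact: Lambda_act_module covpi.
- by move=> g h x m; exact: Lambda_actE.
- by move=> g h x m; exact: Lambda_actE2.
Qed.
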